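(* Consider the navigable small-world equilibrium $\mathbf r\equiv k$ for the DRB game in a $k$-dimensional grid ($k>1$). Suppose that with probability $p_u$ each node $u\in V$ independently perturbs $r_u$ to an arbitrary strategy $r'_u\in\Sigma$, and with probability $1-p_u$ $r'_u=r_u$. Let $\alpha_{\min}=\min_{u\in V}\alpha_u$. Then for any constant $\varepsilon$ with $0<\varepsilon<\min\{1,\alpha_{\min}\}\gamma/4$, there exists $n_0\in\mathbb N$ (depending only on $k$, $\gamma$ and $\varepsilon$) such that for all $n\ge n_0$, if $p_u\le 1-n^{-\varepsilon}$ for every $u\in V$, then with probability at least $1-1/n$ the perturbed strategy profile $\mathbf r'$ moves back to the navigable small world ($\mathbf r\equiv k$) in one synchronous step, or as soon as every node takes at least one asynchronous step, in the best response dynamics.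
   Context: DRB (Distance-Reciprocity Balanced) game. Fix an integer $k$ and $\gamma=1/g$ with $g\ge 2$ an integer. For an integer $n\ge 2$ let $V=\{1,\dots,n\}^k$, viewed as a torus grid with distance $d_M(u,v)=\sum_{i=1}^k\min\{|u_i-v_i|,\,n-|u_i-v_i|\}$. Each node $u\in V$ is a player with strategy $r_u\in\Sigma=\{0,\gamma,2\gamma,3\gamma,\dots\}$ and a constant exponent $\alpha_u>0$ (possibly different for different nodes). For $r\ge 0$ let $c(r)=\sum_{v\ne u}d_M(u,v)^{-r}$ (independent of $u$) and $p_u(v,r)=d_M(u,v)^{-r}/c(r)$ for $v\neq u$ (a different object from the perturbation probability $p_u$ in the statement). The payoff of $u$ under the strategy profile $\mathbf r=(r_v)_{v\in V}$ is $$\pi_u(r_u,\mathbf r_{-u})=\Big(\sum_{v\ne u}p_u(v,r_u)\,d_M(u,v)\Big)^{\alpha_u}\Big(\sum_{v\ne u}p_u(v,r_u)\,p_v(u,r_v)\Big).$$ $\mathbf r\equiv s$ means $r_u=s$ for all $u\in V$. A strategy $r_u^*\in\Sigma$ is a best response to $\mathbf r_{-u}$ if $\pi_u(r_u^*,\mathbf r_{-u})\ge\pi_u(r_u,\mathbf r_{-u})$ for all $r_u\in\Sigma$. Best response dynamics: in an asynchronous step, one player moves from its current strategy to its best response to the current strategy profile, the others staying put; in a synchronous step, every player moves from its current strategy to its best response to the current strategy profile.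
   Formalization: The exponents α_u are assumed bounded by a constant A independent of n, and n_0 may depend on A as well as k, γ, ε; with n_0 depending only on k, γ, ε the claim fails for very large α_u at fixed n, where strategy 0 beats k. *)

(* Defs.v *)
From HB Require Import structures.
From mathcomp Require Import all_boot all_order all_algebra.
From mathcomp Require Import all_classical all_reals all_analysis.

Set Implicit Arguments.
Unset Strict Implicit.
Unset Printing Implicit Defensive.

Import Order.TTheory GRing.Theory Num.Theory.
Local Open Scope classical_set_scope.
Local Open Scope ring_scope.

(* The torus grid {1, ..., n}^k; coordinates are numbered from 0, which does
   not affect the distance. *)
Definition node (k n : nat) := {ffun 'I_k -> 'I_n}.

Definition torus_dist (k n : nat) (u v : node k n) : nat :=
  (\sum_(i < k) minn `|(u i : nat) - (v i : nat)|
                     (n - `|(u i : nat) - (v i : nat)|))%N.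

(* Sigma = {0, gamma, 2 gamma, ...} with gamma = 1/g *)
Definition strategies (R : realType) (g : nat) : set R :=
  [set s | exists m : nat, s = m%:R * g%:R^-1].

Definition profile (R : realType) (k n : nat) := {ffun node k n -> R}.

Definition constant_profile (R : realType) (k n : nat) (s : R) :
  profile R k n := [ffun => s].

Section Game.
Context {R : realType} {k n : nat}.
Implicit Types (u v : node k n) (s : R) (r q target : profile R k n).

Definition dist_weight u v s : R := (torus_dist u v)%:R `^ (- s).

(* c(s); by translation invariance of the torus it does not depend on u. *)
Definition normalizer u s : R := \sum_(v | v != u) dist_weight u v s.

Definition link_prob u v s : R := dist_weight u v s / normalizer u s.

Variables (g : nat) (alpha : node k n -> R).

(* Payoff of u when it plays s and every other node v plays r v; the entry
   r u is not used. *)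
Definition payoff u s r : R :=
  (\sum_(v | v != u) link_prob u v s * (torus_dist u v)%:R) `^ alpha u *
  (\sum_(v | v != u) link_prob u v s * link_prob v u (r v)).

Definition best_response u r s : Prop :=
  strategies g s /\
  forall t, strategies g t -> payoff u t r <= payoff u s r.

Definition sync_step r q : Prop := forall u, best_response u r (q u).

Definition async_step u r q : Prop :=
  best_response u r (q u) /\ forall v, v != u -> q v = r v.

(* Best responses are a priori neither unique nor guaranteed to exist (the
   strategy set is infinite), so the steps are relations: we ask that a step
   be possible and that every possible outcome be the target. *)
Definition sync_returns r target : Prop :=
  (exists q, sync_step r q) /\ (forall q, sync_step r q -> q = target).

(* The players listed in sched move in turn: no execution from r gets stuck,
   and every execution ends in the target. *)
Fixpoint async_returns (sched : seq (node k n)) r target : Prop :=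
  match sched with
  | [::] => r = target
  | u :: sched' =>
      (exists q, async_step u r q) /\
      (forall q, async_step u r q -> async_returns sched' q target)
  end.

Definition moves_back r target : Prop :=
  sync_returns r target /\
  (forall sched : seq (node k n),
     (forall u, u \in sched) -> async_returns sched r target).

(* The minimum of alpha over the nodes (attained, the set of nodes being
   finite and nonempty). *)
Definition alpha_min : R := inf (range alpha).

End Game.

Definition mutually_independent (d : measure_display) (T : measurableType d)
    (R : realType) (P : probability T R) (I : finType) (D : I -> set T) :
    Prop :=
  forall J : {set I},
    P (\bigcap_(i in [set` J]) D i) = (\prod_(i in J) P (D i))%E.

(* Main.v *)
Require Import Defs.
From HB Require Import structures.
From mathcomp Require Import all_boot all_order all_algebra.
From mathcomp Require Import all_classical all_reals all_analysis.
From mathcomp Require Import zify ring lra.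

Set Implicit Arguments.
Unset Strict Implicit.
Unset Printing Implicit Defensive.

Import Order.TTheory GRing.Theory Num.Theory.
Local Open Scope classical_set_scope.
Local Open Scope ring_scope.

(** Write gamma = 1/g, and let G be a large constant times ln n.  Balls of
    radius m contain about m^k nodes, so c(k) <= G, and by monotonicity
    p_v(u, r) <= C d(u,v)^-k whatever the strategy r >= 0 of v.  Hence,
    whatever the other nodes play, a strategy s >= k + gamma has payoff at most
    (n^(1-gamma) G^2)^alpha, because the expected distance drops, and a strategy
    s <= k - gamma has payoff at most (G n)^alpha n^(-gamma) G^2, because the
    reciprocity drops.  As soon as a single node v with d(u,v)^k <= G n^eps still
    plays k, the strategy k yields at least (n/G^2)^alpha / (G^4 n^(2 eps)),
    which is larger since 4 eps < min(1, alpha) gamma and G is polylogarithmic.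
    Independence makes the probability that all the nodes in such a ball around
    a given u are perturbed at most n^-(k+1), and there are n^k nodes.  The set of
    nodes that play k only grows along the dynamics, so k remains the unique best
    response of every node. *)

(** * Counting points on the cycle *)

Definition cycle_dist (n a b : nat) : nat :=
  minn `|a - b|%N (n - `|a - b|)%N.

(** Going round in one direction suffices: [a, a+1, ..., a+m] modulo [n] are distinct since
    [m < n]. *)
Lemma card_cycle_ball_ge n m (a : 'I_n) : (m < n)%N ->
  (m < #|[pred b : 'I_n | (cycle_dist n a b <= m)%N]|)%N.
Proof.
case: n a => [[]//|n] a ltmn.
have [f fE] : exists f : 'I_m.+1 -> 'I_n.+1, forall i,
    f i = (if a + i < n.+1 then a + i else a + i - n.+1)%N :> nat.
  exists (fun i => inord (if a + i < n.+1 then a + i else a + i - n.+1)%N).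
  move=> i; rewrite inordK//; have := ltn_ord a; have := ltn_ord i.
  by case: ifP => ?; lia.
have f_inj : injective f.
  move=> i j /(congr1 val); rewrite /= !fE => fij; apply/val_inj => /=.
  have := ltn_ord a; have := ltn_ord i; have := ltn_ord j.
  by move: fij; case: ifP => ?; case: ifP => ?; lia.
rewrite -[m.+1]card_ord -(card_codom f_inj); apply/subset_leq_card/fintype.subsetP.
move=> _ /codomP[i ->]; rewrite inE /cycle_dist fE.
by have := ltn_ord a; have := ltn_ord i; case: ifP => ?; lia.
Qed.

(** The points [a + i] and [a - i] modulo the length, for [i <= m], cover the ball; counting [a]
    twice is harmless. *)
Lemma card_cycle_ball_le n m (a : 'I_n) :
  (#|[pred b : 'I_n | (cycle_dist n a b <= m)%N]| <= 2 * m.+1)%N.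
Proof.
case: n a => [[]//|n] a.
pose s : seq 'I_n.+1 := [seq inord ((a + i) %% n.+1) | i <- iota 0 m.+1] ++
  [seq inord ((a + n.+1 - i) %% n.+1) | i <- iota 0 m.+1].
rewrite (_ : 2 * m.+1 = size s)%N; last first.
  by rewrite size_cat !size_map !size_iota mul2n addnn.
apply: leq_trans (card_size s); apply/subset_leq_card/fintype.subsetP => b.
rewrite inE /cycle_dist /s mem_cat => {s} le_m; apply/orP.
have lta := ltn_ord a; have ltb := ltn_ord b.
have modl (x : nat) : (x = b :> nat \/ x = (b + n.+1)%N) ->
    b = inord (x %% n.+1) :> 'I_n.+1.
  by move=> [] ->; apply/val_inj; rewrite /= ?modnDr modn_small// inordK.
case: (leqP `|a - b|%N m) => [le|gt].
  have [ltab|leba] := ltnP a b; [left|right]; apply/mapP.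
    by exists (b - a)%N; [rewrite mem_iota; lia|apply: modl; lia].
  by exists (a - b)%N; [rewrite mem_iota; lia|apply: modl; lia].
have [ltab|leba] := ltnP a b; [right|left]; apply/mapP.
  by exists (a + n.+1 - b)%N; [rewrite mem_iota; lia|apply: modl; lia].
by exists (b + n.+1 - a)%N; [rewrite mem_iota; lia|apply: modl; lia].
Qed.

(** * Distances and ball sizes in the torus *)

Section TorusDistance.
Variables (k n : nat).
Implicit Types (u v w : node k n).

Lemma torus_distE u v :
  torus_dist u v = (\sum_(i < k) cycle_dist n (u i) (v i))%N.
Proof. by []. Qed.

Lemma torus_distC u v : torus_dist u v = torus_dist v u.
Proof. by apply: eq_bigr => i _; rewrite distnC. Qed.

Lemma torus_dist_gt0 u v : v != u -> (0 < torus_dist u v)%N.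
Proof.
apply: contraNT; rewrite -eqn0Ngt torus_distE sum_nat_eq0 => /forallP uv.
apply/eqP/ffunP => i; apply/val_inj => /=.
have := uv i; rewrite /= /cycle_dist.
by have := ltn_ord (u i); have := ltn_ord (v i); lia.
Qed.

(** The factor one half is what keeps [d %/ k] below [n] in [link_prob_le]. *)
Lemma torus_dist_le_half u v : (torus_dist u v <= k * n./2)%N.
Proof.
rewrite -[X in (_ <= X * _)%N]card_ord -sum_nat_const; apply: leq_sum => i _.
by lia.
Qed.

Lemma torus_dist_le u v : (torus_dist u v <= k * n)%N.
Proof.
by apply: leq_trans (torus_dist_le_half u v) _; rewrite leq_mul2l; lia.
Qed.

Lemma card_box (F : 'I_k -> pred 'I_n) :
  #|[pred w : node k n | [forall i, F i (w i)]]| = (\prod_(i < k) #|F i|)%N.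
Proof.
rewrite -(eq_card (A := family F)); last by move=> w; rewrite !inE.
by rewrite card_family foldrE big_map big_enum.
Qed.

(** The sup-norm box of radius [m] lies in the ball of radius [k * m] and has at least
    [(m+1)^k > m^k] points, so [m^k] remain once [u] is removed. *)
Lemma card_punctured_ball_ge u m : (0 < k)%N -> (m < n)%N ->
  (m ^ k <= #|[pred w : node k n | (w != u) && (torus_dist u w <= k * m)]|)%N.
Proof.
move=> k0 ltmn.
pose box := [pred w : node k n | [forall i, (cycle_dist n (u i) (w i) <= m)%N]].
have box_ge : (m.+1 ^ k <= #|box|)%N.
  rewrite (card_box (fun i => [pred b : 'I_n | (cycle_dist n (u i) b <= m)%N])).
  rewrite -[k in (_ ^ k)%N]card_ord -prod_nat_const; apply: leq_prod => i _.
  exact: card_cycle_ball_ge.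
have u_box : u \in box.
  by rewrite inE; apply/forallP => i; rewrite /cycle_dist distnn min0n.
have lt_exp : (m ^ k < m.+1 ^ k)%N by rewrite ltn_exp2r.
have box_gt : (m ^ k < #|box|)%N := leq_trans lt_exp box_ge.
rewrite (cardD1 u) u_box add1n ltnS in box_gt.
apply: leq_trans box_gt _; apply/subset_leq_card/fintype.subsetP => w.
rewrite !inE => /andP[-> /forallP dw] /=.
rewrite -[k in (_ <= k * _)%N]card_ord -sum_nat_const; apply: leq_sum => i _.
exact: dw.
Qed.

Lemma card_ball_le u m :
  (#|[pred w : node k n | (torus_dist u w <= m)%N]| <= (2 * m.+1) ^ k)%N.
Proof.
apply: (@leq_trans #|[pred w : node k n |
    [forall i, (cycle_dist n (u i) (w i) <= m)%N]]|).
  apply/subset_leq_card/fintype.subsetP => w; rewrite !inE => dw; apply/forallP => i.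
  apply: leq_trans dw; rewrite torus_distE (bigD1 i)//=; exact: leq_addr.
rewrite (card_box (fun i => [pred b : 'I_n | (cycle_dist n (u i) b <= m)%N])).
rewrite -[k in (_ ^ k)%N]card_ord -prod_nat_const; apply: leq_prod => i _.
exact: card_cycle_ball_le.
Qed.

Lemma torus_neighbor u : (0 < k)%N -> (1 < n)%N ->
  exists2 v, v != u & torus_dist u v = 1%N.
Proof.
move=> k0 n1; pose i0 := Ordinal k0.
have [b bu db] : exists2 b, b != u i0 & (cycle_dist n (u i0) b <= 1)%N.
  have := card_cycle_ball_ge (u i0) n1.
  rewrite (cardD1 (u i0)) inE {1}/cycle_dist distnn min0n leq0n add1n ltnS.
  by case/card_gt0P => b; rewrite !inE => /andP[]; exists b.
pose v : node k n := [ffun i => if i == i0 then b else u i].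
have vu : v != u by apply: contra_neq bu => /ffunP/(_ i0); rewrite ffunE eqxx.
exists v => //; apply/eqP; rewrite eqn_leq torus_dist_gt0// andbT.
rewrite torus_distE (bigD1 i0)//= big1 ?addn0 => [|i /negPf ii0].
  by rewrite ffunE eqxx.
by rewrite ffunE ii0 /cycle_dist distnn min0n.
Qed.

End TorusDistance.

(** * Normalizers and link probabilities *)

Section Links.
Context {R : realType} {k n : nat}.
Hypotheses (k0 : (0 < k)%N) (n1 : (1 < n)%N).
Implicit Types (u v w : node k n) (s t : R).

Let dist_gt0 u v : v != u -> 0 < (torus_dist u v)%:R :> R.
Proof. by move=> vu; rewrite ltr0n torus_dist_gt0. Qed.

Let dist_ge1 u v : v != u -> 1 <= (torus_dist u v)%:R :> R.
Proof. by move=> vu; rewrite ler1n torus_dist_gt0. Qed.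

Lemma dist_weight_ge0 u v s : 0 <= dist_weight u v s.
Proof. exact: powR_ge0. Qed.

Lemma dist_weight_le u v s t : v != u -> s <= t ->
  dist_weight u v t <= dist_weight u v s.
Proof. by move=> vu st; rewrite ler_powR ?dist_ge1// lerN2. Qed.

Lemma dist_weight_le1 u v s : v != u -> 0 <= s -> dist_weight u v s <= 1.
Proof.
move=> vu s0; apply: le_trans (dist_weight_le vu s0) _.
by rewrite /dist_weight oppr0 powRr0.
Qed.

Lemma dist_weight_natE u v : dist_weight u v k%:R = (torus_dist u v)%:R ^- k :> R.
Proof. by rewrite /dist_weight powR_invn. Qed.

Lemma dist_weight_mul_dist u v s : v != u ->
  dist_weight u v s * (torus_dist u v)%:R = (torus_dist u v)%:R `^ (1 - s).
Proof.
move=> vu; rewrite addrC powRD ?(gt_eqF (dist_gt0 vu)) ?implybT//.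
by rewrite powRr1.
Qed.

(** A neighbor at distance 1 has weight 1 for every exponent. *)
Lemma normalizer_ge1 u s : 1 <= normalizer u s.
Proof.
have [v vu duv] := torus_neighbor u k0 n1.
rewrite /normalizer (bigD1 v)//= {1}/dist_weight duv powR1.
by rewrite lerDl sumr_ge0// => w _; exact: dist_weight_ge0.
Qed.

Lemma normalizer_gt0 u s : 0 < normalizer u s.
Proof. exact: lt_le_trans ltr01 (normalizer_ge1 u s). Qed.

Lemma link_prob_ge0 u v s : 0 <= link_prob u v s.
Proof. by rewrite divr_ge0 ?dist_weight_ge0 ?(ltW (normalizer_gt0 _ _)). Qed.

Lemma sum_link_prob u s : \sum_(v | v != u) link_prob u v s = 1.
Proof. by rewrite -mulr_suml divff ?gt_eqF ?normalizer_gt0. Qed.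

Lemma link_prob_le1 u v s : v != u -> link_prob u v s <= 1.
Proof.
move=> vu; rewrite -(sum_link_prob u s) (bigD1 v)//= lerDl.
by rewrite sumr_ge0// => w _; exact: link_prob_ge0.
Qed.

Lemma link_prob_le_weight u v s : v != u -> link_prob u v s <= dist_weight u v s.
Proof.
move=> vu; rewrite ler_pdivrMr ?normalizer_gt0//.
by rewrite ler_peMr ?dist_weight_ge0 ?normalizer_ge1.
Qed.

(* Dyadic shells: the at most [(4 * 2 ^ i) ^ k] nodes at distance between [2 ^ i]
   and [2 ^ i.+1] contribute at most [4 ^ k]. *)
Lemma normalizer_le_log u :
  normalizer u k%:R <= 4 ^+ k * (trunc_log 2 (k * n)).+1%:R :> R.
Proof.
set L := (trunc_log 2 (k * n)).+1.
pose shell v : 'I_L := inord (trunc_log 2 (torus_dist u v)).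
rewrite /normalizer (partition_big shell xpredT)//=.
have -> : 4 ^+ k * L%:R = \sum_(i < L) 4 ^+ k :> R.
  by rewrite sumr_const card_ord mulr_natr.
apply: ler_sum => i _.
have shell_bounds v : (v != u) && (shell v == i) ->
    (2 ^ i <= torus_dist u v < 2 ^ i.+1)%N.
  move=> /andP[vu /eqP <-]; rewrite inordK.
    by apply: trunc_log_bounds => //; exact: torus_dist_gt0.
  by rewrite ltnS leq_trunc_log// torus_dist_le.
apply: (@le_trans _ _ (\sum_(v | (v != u) && (shell v == i)) (2 ^+ i) ^- k)).
  apply: ler_sum => v vi; rewrite dist_weight_natE.
  have /andP[lo _] := shell_bounds v vi.
  rewrite lef_pV2 ?posrE ?exprn_gt0// ?ltr0n; last first.
    by apply: leq_trans lo; rewrite expn_gt0.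
  by rewrite lerXn2r ?nnegrE ?exprn_ge0// -natrX ler_nat.
rewrite sumr_const -[_ *+ #|_|]mulr_natr ler_pdivrMl ?exprn_gt0// mulrC.
rewrite -exprMn -[4]/(4%:R) -natrX -natrM -natrX ler_nat.
(* The strict upper end of the shell gives radius [2^(i+1) - 1], so [card_ball_le] yields exactly
   [(2 * 2^(i+1))^k = (4 * 2^i)^k]. *)
apply: (@leq_trans #|[pred v : node k n | (torus_dist u v <= (2 ^ i.+1).-1)%N]|).
  apply/subset_leq_card/fintype.subsetP => v /shell_bounds/andP[_].
  by rewrite inE; lia.
apply: leq_trans (card_ball_le _ _) _; rewrite prednK ?expn_gt0//.
by rewrite leq_exp2r// expnS mulnA.
Qed.

(* The nodes at least as close to [v] as [u] have in total probability at most
   1, and each of them is at least as likely as [u]. *)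
Lemma link_prob_le u v s : v != u -> 0 <= s ->
  link_prob v u s <= (2 * k)%:R ^+ k * dist_weight u v k%:R.
Proof.
move=> vu s0; set d := torus_dist u v.
have uv : u != v by rewrite eq_sym.
have d0 : (0 < d)%N by exact: torus_dist_gt0.
pose B := [pred w : node k n | (w != v) && (torus_dist v w <= d)%N].
(* For [d < k] the radius [d %/ k] vanishes, and [u] alone in [B] suffices. Otherwise [B] contains a
   punctured ball with at least [(d %/ k)^k] nodes, and [d <= 2k (d %/ k)]. *)
have cardB : (d ^ k <= (2 * k) ^ k * #|B|)%N.
  have [ltdk|ledk] := ltnP d k.
    apply: (@leq_trans (k ^ k)); first by rewrite leq_exp2r// ltnW.
    rewrite -[X in (X <= _)%N]muln1 leq_mul//.
      by rewrite leq_exp2r// leq_pmull.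
    by apply/card_gt0P; exists u; rewrite !inE uv torus_distC leqnn.
  have m0 : (0 < d %/ k)%N by rewrite divn_gt0.
  have mn : (d %/ k < n)%N.
    apply: (@leq_ltn_trans n./2); last by lia.
    by rewrite -(mulKn n./2 k0) leq_div2r// torus_dist_le_half.
  apply: (@leq_trans ((2 * k) ^ k * (d %/ k) ^ k)).
    rewrite -expnMn leq_exp2r//.
    by have := ltn_ceil d k0; nia.
  rewrite leq_mul2l; apply/orP; right.
  apply: leq_trans (card_punctured_ball_ge v k0 mn) _.
  apply/subset_leq_card/fintype.subsetP => w; rewrite !inE => /andP[-> /=].
  by move=> /leq_trans; apply; rewrite mulnC leq_divM.
have B0 : (0 < #|B|)%N.
  by apply/card_gt0P; exists u; rewrite !inE uv torus_distC leqnn.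
have norm_ge : #|B|%:R * dist_weight v u s <= normalizer v s.
  rewrite mulr_natl -sumr_const /normalizer big_mkcondr/=.
  apply: ler_sum => w wv; case: ifP => [dw|_]; last exact: dist_weight_ge0.
  rewrite /dist_weight !powRN lef_pV2 ?posrE ?powR_gt0 ?dist_gt0//.
  by rewrite ge0_ler_powR ?nnegrE// ler_nat (leq_trans dw)// /d torus_distC.
apply: (@le_trans _ _ #|B|%:R^-1).
  rewrite ler_pdivrMr ?normalizer_gt0//.
  by rewrite ler_pdivlMl ?ltr0n.
rewrite dist_weight_natE ler_pdivlMr ?exprn_gt0 ?ltr0n//.
rewrite ler_pdivrMl ?ltr0n// mulrC.
by rewrite -!natrX -natrM ler_nat.
Qed.

Let card_others u : #|[pred v : node k n | v != u]|%:R = n%:R ^+ k - 1 :> R.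
Proof.
have := cardC1 u; rewrite card_ffun !card_ord => ->.
by rewrite -subn1 natrB ?expn_gt0 ?(ltnW n1)// natrX.
Qed.

Let half_le : n%:R ^+ k / 2 <= n%:R ^+ k - 1 :> R.
Proof.
suff : 2 <= n%:R ^+ k :> R by lra.
rewrite -natrX ler_nat; apply: leq_trans n1 _.
by rewrite -[X in (X <= _)%N]expn1 leq_exp2l.
Qed.

(** At least [n^k / 2] other nodes exist, all within distance [k n]. This serves both as a lower
    bound on normalizers and, with [s = k - 1], on the expected distance. *)
Lemma sum_powR_dist_ge u s : 0 <= s ->
  n%:R ^+ k / 2 * (k * n)%:R `^ (- s) <=
    \sum_(v | v != u) (torus_dist u v)%:R `^ (- s).
Proof.
move=> s0; apply: (@le_trans _ _ ((n%:R ^+ k - 1) * (k * n)%:R `^ (- s))).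
  by rewrite ler_wpM2r ?powR_ge0.
rewrite -(card_others u) mulr_natl -sumr_const; apply: ler_sum => v vu.
rewrite !powRN lef_pV2 ?posrE ?powR_gt0 ?dist_gt0// ?ltr0n ?muln_gt0 ?k0 ?(ltnW n1)//.
by rewrite ge0_ler_powR ?nnegrE// ler_nat torus_dist_le.
Qed.

End Links.

(** * Payoff bounds at, above and below the exponent [k] *)

Section PayoffBounds.
Context {R : realType} {k n : nat}.
Variables (alpha : node k n -> R) (gamma eps G : R).
Hypotheses (k1 : (1 < k)%N) (n1 : (1 < n)%N).
Hypothesis alpha_gt0 : forall u, 0 < alpha u.
Hypotheses (gamma_gt0 : 0 < gamma) (gamma_le1 : gamma <= 1).
Hypothesis constants_le : 2 * (k%:R ^+ k * (2 * k)%:R ^+ k) <= G.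
Hypothesis normalizer_le : forall u : node k n, normalizer u k%:R <= G.
Implicit Types (u v w : node k n) (s t : R) (r : profile R k n).

Let k0 : (0 < k)%N := ltnW k1.
Let nR0 : 0 < n%:R :> R. Proof. by rewrite ltr0n ltnW. Qed.
Let kR1 : 1 <= k%:R :> R. Proof. by rewrite ler1n. Qed.
Let kR0 : 0 < k%:R :> R. Proof. by rewrite ltr0n. Qed.
Let kXk1 : 1 <= k%:R ^+ k :> R. Proof. by rewrite exprn_ege1. Qed.
Let kkXk1 : 1 <= (2 * k)%:R ^+ k :> R.
Proof. by rewrite exprn_ege1// ler1n muln_gt0. Qed.
Let kXk_leG : 2 * k%:R ^+ k <= G.
Proof.
by apply: le_trans constants_le; rewrite ler_wpM2l// ler_peMr// (le_trans ler01).
Qed.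
Let k_leG : k%:R <= G.
Proof.
apply: le_trans kXk_leG; apply: (@le_trans _ _ (k%:R ^+ k)).
  by rewrite -[X in X <= _]expr1 ler_eXn2l// ?ltr1n.
by rewrite ler_peMl ?exprn_ge0//; lra.
Qed.
Let G1 : 1 <= G. Proof. exact: le_trans kR1 k_leG. Qed.
Let G0 : 0 < G. Proof. exact: lt_le_trans G1. Qed.

Let expected_dist_ge0 u s :
  0 <= \sum_(v | v != u) link_prob u v s * (torus_dist u v)%:R.
Proof. by apply: sumr_ge0 => v _; rewrite mulr_ge0 ?link_prob_ge0. Qed.

Let reciprocity_ge0 u s r :
  0 <= \sum_(v | v != u) link_prob u v s * link_prob v u (r v).
Proof. by apply: sumr_ge0 => v _; rewrite mulr_ge0 ?link_prob_ge0. Qed.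

Lemma payoff_le u s r (a b : R) : 0 <= a ->
  \sum_(v | v != u) link_prob u v s * (torus_dist u v)%:R <= a ->
  \sum_(v | v != u) link_prob u v s * link_prob v u (r v) <= b ->
  payoff alpha u s r <= a `^ alpha u * b.
Proof.
move=> a0 le_a le_b; rewrite ler_pM ?powR_ge0//.
by rewrite ge0_ler_powR ?nnegrE// ltW.
Qed.

(** Since [d * d^-k = d^-(k-1)], the sum before normalization is at least
    [n / (2 k^(k-1)) >= n / G]; the normalizer costs another factor [G]. *)
Lemma expected_dist_navigable_ge u :
  n%:R / G ^+ 2 <=
    \sum_(v | v != u) link_prob u v k%:R * (torus_dist u v)%:R.
Proof.
have -> : \sum_(v | v != u) link_prob u v k%:R * (torus_dist u v)%:R =
    (\sum_(v | v != u) (torus_dist u v)%:R `^ (- (k.-1)%:R)) / normalizer u k%:R :> R.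
  rewrite mulr_suml; apply: eq_bigr => v vu.
  rewrite /link_prob mulrAC dist_weight_mul_dist//.
  by rewrite -subn1 natrB// opprB.
apply: (@le_trans _ _ ((n%:R / G) / G)); first by rewrite expr2 invfM mulrA.
have sum_ge : n%:R / G <=
    \sum_(v | v != u) (torus_dist u v)%:R `^ (- (k.-1)%:R) :> R.
  apply: le_trans (sum_powR_dist_ge k0 n1 u _); last exact: ler0n.
  rewrite powR_invn// natrM exprMn.
  have -> : n%:R ^+ k / 2 / (k%:R ^+ k.-1 * n%:R ^+ k.-1) =
      n%:R / (2 * k%:R ^+ k.-1) :> R.
    rewrite -[X in n%:R ^+ X](prednK k0) exprS; field.
    by rewrite !expf_neq0 ?gt_eqF// !pnatr_eq0 -!lt0n k0 ltnW.
  rewrite ler_pM2l// lef_pV2 ?posrE ?mulr_gt0 ?exprn_gt0//.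
  by apply: le_trans kXk_leG; rewrite ler_pM2l// ler_weXn2l// leq_pred.
apply: ler_pM => //; first by rewrite divr_ge0// ltW.
  by rewrite invr_ge0 ltW.
by rewrite lef_pV2 ?posrE ?normalizer_gt0.
Qed.

(** The single term of [v] in the reciprocity sum is enough: both of its link probabilities are at
    least [1 / (G * (G n^eps))]. *)
Lemma payoff_navigable_ge u v r : v != u -> r v = k%:R ->
  (torus_dist u v)%:R ^+ k <= G * n%:R `^ eps ->
  (n%:R / G ^+ 2) `^ alpha u / (G ^+ 4 * n%:R `^ (2 * eps)) <=
    payoff alpha u k%:R r.
Proof.
move=> vu rv dv; apply: ler_pM.
- exact: powR_ge0.
- by rewrite invr_ge0 mulr_ge0 ?powR_ge0 ?exprn_ge0// ltW.
- rewrite ge0_ler_powR ?nnegrE ?expected_dist_navigable_ge//.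
    by rewrite ltW.
  by rewrite divr_ge0// exprn_ge0// ltW.
have link_ge (x y : node k n) : torus_dist x y = torus_dist u v ->
    (G ^+ 2 * n%:R `^ eps)^-1 <= link_prob x y k%:R :> R.
  move=> dxy; rewrite /link_prob dist_weight_natE dxy -invfM.
  have d0 : 0 < (torus_dist u v)%:R :> R by rewrite ltr0n torus_dist_gt0.
  rewrite lef_pV2 ?posrE ?mulr_gt0 ?exprn_gt0 ?powR_gt0 ?normalizer_gt0//.
  rewrite expr2 -mulrA mulrC; apply: ler_pM => //.
  by rewrite ltW// normalizer_gt0.
rewrite (bigD1 v)//= rv -[X in X <= _]addr0; apply: lerD; last first.
  by apply: sumr_ge0 => w _; rewrite mulr_ge0 ?link_prob_ge0.
have -> : (G ^+ 4 * n%:R `^ (2 * eps))^-1 =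
    (G ^+ 2 * n%:R `^ eps)^-1 * (G ^+ 2 * n%:R `^ eps)^-1.
  rewrite -invfM mulrACA -exprD -powRD ?(gt_eqF nR0) ?implybT//.
  by congr (_ * _ `^ _)^-1; ring.
have ge0 : 0 <= (G ^+ 2 * n%:R `^ eps)^-1.
  by rewrite invr_ge0 mulr_ge0 ?powR_ge0 ?exprn_ge0// ltW.
by apply: ler_pM => //; apply: link_ge => //; exact: torus_distC.
Qed.

(** Reciprocity is at most 1. For the distance, [d^(1-s) <= d^-k * (k n)^(1-gamma)], and the sum of
    the [d^-k] is [c(k) <= G]. *)
Lemma payoff_above_le u s r : k%:R + gamma <= s ->
  payoff alpha u s r <= (n%:R `^ (1 - gamma) * G ^+ 2) `^ alpha u.
Proof.
move=> le_s; rewrite -[X in _ <= X]mulr1; apply: payoff_le.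
- by rewrite mulr_ge0 ?powR_ge0 ?exprn_ge0// ltW.
- apply: (@le_trans _ _ (\sum_(v | v != u)
      dist_weight u v k%:R * (k * n)%:R `^ (1 - gamma))).
    apply: ler_sum => v vu.
    have d0 : 0 < (torus_dist u v)%:R :> R by rewrite ltr0n torus_dist_gt0.
    apply: (@le_trans _ _ (dist_weight u v s * (torus_dist u v)%:R)).
      by rewrite ler_wpM2r// link_prob_le_weight.
    rewrite dist_weight_mul_dist//.
    apply: (@le_trans _ _ ((torus_dist u v)%:R `^ (- k%:R + (1 - gamma)))).
      by rewrite ler_powR ?ler1n ?torus_dist_gt0//; lra.
    rewrite powRD ?(gt_eqF d0) ?implybT// ler_wpM2l ?powR_ge0//.
    by rewrite ge0_ler_powR ?nnegrE ?subr_ge0// ler_nat torus_dist_le.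
  rewrite -mulr_suml natrM powRM// mulrA [X in _ <= X]mulrC expr2.
  rewrite ler_wpM2r ?powR_ge0// ler_pM ?powR_ge0 ?normalizer_le//.
    by rewrite ltW// normalizer_gt0.
  by apply: le_trans k_leG; apply: ler1_powR => //; rewrite gerBl ltW.
have <- := sum_link_prob k0 n1 u s; apply: ler_sum => v vu.
by rewrite ler_piMr ?link_prob_ge0// link_prob_le1// eq_sym.
Qed.

(** Far nodes alone force [c(s) >= n^gamma / (2 k^k)], so every link of [u] has probability at most
    [2 k^k n^-gamma]; the opposite links sum to at most [(2k)^k c(k)] by [link_prob_le]. The
    distance is bounded trivially by [k n]. *)
Lemma payoff_below_le u s r : 0 <= s <= k%:R - gamma ->
  (forall v, 0 <= r v) ->
  payoff alpha u s r <=
    (G * n%:R) `^ alpha u * (n%:R `^ (- gamma) * G ^+ 2).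
Proof.
move=> /andP[s0 le_s] r0; apply: payoff_le.
- by rewrite mulr_ge0// ltW.
- apply: (@le_trans _ _ (\sum_(v | v != u) link_prob u v s * (G * n%:R))).
    apply: ler_sum => v vu; rewrite ler_wpM2l ?link_prob_ge0//.
    apply: (@le_trans _ _ (k * n)%:R); first by rewrite ler_nat torus_dist_le.
    by rewrite natrM ler_wpM2r.
  by rewrite -mulr_suml sum_link_prob// mul1r.
have link_le v : v != u -> link_prob u v s <= 2 * k%:R ^+ k * n%:R `^ (- gamma).
  move=> vu; apply: (@le_trans _ _ (normalizer u s)^-1).
    rewrite -[X in _ <= X]mul1r ler_wpM2r ?dist_weight_le1//.
    by rewrite invr_ge0 ltW// normalizer_gt0.
  rewrite powRN -invf_div lef_pV2 ?posrE ?normalizer_gt0//; last first.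
    by rewrite divr_gt0 ?mulr_gt0 ?exprn_gt0 ?powR_gt0.
  apply: le_trans (sum_powR_dist_ge k0 n1 u s0).
  have -> : n%:R ^+ k / 2 * (k * n)%:R `^ (- s) =
      n%:R `^ (k%:R - s) * (2 * k%:R `^ s)^-1.
    rewrite natrM powRM// powRD ?(gt_eqF nR0) ?implybT// powR_mulrn//.
    by rewrite [k%:R `^ (- s)]powRN invfM; ring.
  rewrite ler_pM ?powR_ge0//.
  - by rewrite ler_powR ?ler1n ?(ltnW n1)//; lra.
  rewrite lef_pV2 ?posrE ?mulr_gt0 ?powR_gt0 ?exprn_gt0// ler_pM2l//.
  by rewrite -powR_mulrn// ler_powR// (le_trans le_s)// gerBl ltW.
apply: (@le_trans _ _ (\sum_(v | v != u) 2 * k%:R ^+ k * n%:R `^ (- gamma) *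
    ((2 * k)%:R ^+ k * dist_weight u v k%:R))).
  apply: ler_sum => v vu; apply: ler_pM; rewrite ?link_prob_ge0 ?link_le//.
  exact: link_prob_le.
rewrite -mulr_sumr -mulr_sumr.
rewrite [X in X <= _](_ : _ = n%:R `^ (- gamma) *
  (2 * (k%:R ^+ k * (2 * k)%:R ^+ k) * normalizer u k%:R)); last first.
  by rewrite /normalizer; ring.
rewrite ler_wpM2l ?powR_ge0// expr2 ler_pM//.
  by rewrite ltW// normalizer_gt0.
Qed.

End PayoffBounds.

(** * Comparison of the payoff bounds *)

(* With [x = expR a] and [G = expR b], both sides become linear in [a] and [b]. *)
Lemma navigable_beats_above (R : realType) (x G a A gamma eps : R) :
  1 < x -> 1 <= G -> 0 < a <= A -> 0 < eps -> 4 * eps < a * gamma ->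
  G `^ (4 * A + 6) <= x `^ eps ->
  (x `^ (1 - gamma) * G ^+ 2) `^ a <
    (x / G ^+ 2) `^ a / (G ^+ 4 * x `^ (2 * eps)).
Proof.
move=> x1 G1 /andP[a0 aA] eps0 lt_gamma.
have xE : x = expR (ln x) by rewrite lnK// posrE (lt_trans ltr01).
have GE : G = expR (ln G) by rewrite lnK// posrE (lt_le_trans ltr01).
have lx : 0 < ln x by exact: ln_gt0.
have lG : 0 <= ln G by exact: ln_ge0.
move: (ln x) (ln G) xE GE lx lG => y b -> -> y0 b0.
rewrite -!expRM_natr -!expRN -!expRM -!expRD -!expRM -!expRN -!expRD.
(* The goal amounts to [4ab + 4b + 2 eps y < a gamma y], and [hb] bounds [4ab + 4b] by [eps y]. *)
rewrite ler_expR ltr_expR => hb.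
have ab : a * b <= A * b by rewrite ler_wpM2r.
have gy : 4 * eps * y < a * gamma * y by rewrite ltr_pM2r.
have ey : 0 < eps * y by exact: mulr_gt0.
lra.
Qed.

(** In logarithms this is [3ab + 6b + 2 eps y < gamma y]. The exponent [4A + 6] covers both
    comparisons: 4 comes from [navigable_beats_above], 6 from here. *)
Lemma navigable_beats_below (R : realType) (x G a A gamma eps : R) :
  1 < x -> 1 <= G -> 0 < a <= A -> 0 < eps -> 4 * eps < gamma ->
  G `^ (4 * A + 6) <= x `^ eps ->
  (G * x) `^ a * (x `^ (- gamma) * G ^+ 2) <
    (x / G ^+ 2) `^ a / (G ^+ 4 * x `^ (2 * eps)).
Proof.
move=> x1 G1 /andP[a0 aA] eps0 lt_gamma.
have xE : x = expR (ln x) by rewrite lnK// posrE (lt_trans ltr01).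
have GE : G = expR (ln G) by rewrite lnK// posrE (lt_le_trans ltr01).
have lx : 0 < ln x by exact: ln_gt0.
have lG : 0 <= ln G by exact: ln_ge0.
move: (ln x) (ln G) xE GE lx lG => y b -> -> y0 b0.
rewrite -!expRM_natr -!expRN -!expRM -!expRD -!expRM -!expRN -!expRD.
rewrite ler_expR ltr_expR => hb.
have ab0 : 0 <= a * b by rewrite mulr_ge0// ltW.
have ab : a * b <= A * b by rewrite ler_wpM2r.
have gy : 4 * eps * y < gamma * y by rewrite ltr_pM2r.
have ey : 0 < eps * y by exact: mulr_gt0.
lra.
Qed.

(** * Dynamics with a conditionally dominant strategy *)

Section Dynamics.
Context {R : realType} {k n : nat}.
Variables (g : nat) (alpha : node k n -> R) (c : R) (fixed : node k n -> Prop).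
Implicit Types (u v : node k n) (r q : profile R k n).

(** The invariant of the dynamics: dominance of [c] is only available while the [fixed] nodes play
    [c], and moves to [c] preserve this. *)
Let admissible q : Prop :=
  (forall v, strategies g (q v)) /\ (forall v, fixed v -> q v = c).

Hypothesis c_strategy : strategies g c.
Hypothesis c_dominant : forall q u s, admissible q -> strategies g s -> s != c ->
  payoff alpha u s q < payoff alpha u c q.

Lemma best_response_dominant q u s :
  admissible q -> best_response g alpha u q s <-> s = c.
Proof.
move=> adm; split=> [[ss best]|->]; last first.
  split=> // t st; have [->//|tc] := eqVneq t c.
  by rewrite ltW// c_dominant.
apply/eqP/negPn/negP => sc.
by have := best c c_strategy; rewrite leNgt c_dominant.
Qed.

(** The induction needs the weaker premise that each node is still to move or already plays [c],
    since the schedule shrinks. *)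
Lemma async_returns_dominant (sched : seq (node k n)) q : admissible q ->
  (forall u, u \in sched \/ q u = c) ->
  async_returns g alpha sched q (constant_profile k n c).
Proof.
elim: sched q => [|u sched IH] q adm moved /=.
  by apply/ffunP => v; rewrite ffunE; case: (moved v).
split.
  exists [ffun v => if v == u then c else q v]; split.
    by apply/best_response_dominant => //; rewrite ffunE eqxx.
  by move=> v /negPf vu; rewrite ffunE vu.
move=> q' [/(best_response_dominant _ _ adm) q'u q'E]; apply: IH.
  split=> v; have [->|vu] := eqVneq v u; rewrite ?q'u ?q'E//.
    by case: adm => + _; apply.
  by case: adm => _; apply.
move=> v; have [->|vu] := eqVneq v u; first by right.
by rewrite q'E//; case: (moved v); rewrite ?inE ?(negPf vu)//; [left|right].
Qed.

Lemma moves_back_dominant q : admissible q ->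
  moves_back g alpha q (constant_profile k n c).
Proof.
move=> adm; split; last first.
  by move=> sched all_move; apply: async_returns_dominant => // u; left.
split.
  exists (constant_profile k n c) => u.
  by apply/best_response_dominant => //; rewrite ffunE.
move=> q' step; apply/ffunP => u; rewrite ffunE.
exact/(best_response_dominant _ _ adm).
Qed.

End Dynamics.

(** * Growth and rounding estimates *)

Lemma powR_ln_le_powR (R : realType) (Z B eps : R) : 0 < Z -> 0 < B -> 0 < eps ->
  exists n0 : nat, forall n, (n0 <= n)%N ->
    1 <= ln n%:R :> R /\ (Z * ln n%:R) `^ B <= n%:R `^ eps :> R.
Proof.
(* With this [delta], [ln n <= n^delta / delta] costs only [n^(eps/2)] after raising to the power
   [B]; [n >= Y] absorbs the constant into the other [n^(eps/2)]. *)
move=> Z0 B0 eps0; pose delta := eps / (2 * B).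
have delta0 : 0 < delta by rewrite divr_gt0// mulr_gt0.
pose Y := ((Z / delta) `^ B) `^ (2 / eps).
exists (maxn (Num.bound (expR 1 : R)) (Num.bound Y)) => n.
rewrite geq_max => /andP[n_ge_e n_geY].
have en : expR 1 <= n%:R :> R.
  by apply/ltW/(lt_le_trans (archi_boundP (expR_ge0 1))); rewrite ler_nat.
have Yn : Y <= n%:R.
  by apply/ltW/(lt_le_trans (archi_boundP (powR_ge0 _ _))); rewrite ler_nat.
have n0 : 0 < n%:R :> R by apply: lt_le_trans en; exact: expR_gt0.
have ln1n : 1 <= ln n%:R :> R by rewrite -ler_expR lnK.
split => //; apply: (@le_trans _ _ ((Z / delta * n%:R `^ delta) `^ B)).
  rewrite ge0_ler_powR ?nnegrE ?(ltW B0)//.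
  - by rewrite mulr_ge0 ?(ltW Z0)// (le_trans ler01).
  - by rewrite mulr_ge0 ?powR_ge0// divr_ge0// ltW.
  rewrite -mulrA ler_pM2l// ler_pdivlMl// -ln_powR ltW// ln_sublinear//.
  exact: powR_gt0.
rewrite [X in X <= _]powRM ?powR_ge0//; last by rewrite ltW// divr_gt0.
rewrite -powRrM.
have -> : delta * B = eps / 2 by rewrite /delta; field; rewrite gt_eqF.
have -> : n%:R `^ eps = n%:R `^ (eps / 2) * n%:R `^ (eps / 2) :> R.
  by rewrite -powRD -?splitr// (gt_eqF n0) implybT.
rewrite ler_wpM2r ?powR_ge0//.
apply: (@le_trans _ _ (Y `^ (eps / 2))); last first.
  by rewrite ge0_ler_powR ?nnegrE ?powR_ge0 ?divr_ge0// ltW.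
rewrite /Y -powRrM.
have -> : 2 / eps * (eps / 2) = 1 by field; rewrite gt_eqF.
by rewrite powRr1// powR_ge0.
Qed.

(** Take the least [m] with [x <= m^k]: if [m >= 2], then [m - 1] fails and [m <= 2 (m - 1)]; if
    [m = 1], use [1 <= x]. *)
Lemma exists_expn_approx (R : realType) (k : nat) (x : R) : (0 < k)%N -> 1 <= x ->
  exists2 m : nat, (0 < m)%N & x <= m%:R ^+ k <= 2 ^+ k * x.
Proof.
move=> k0 x1.
have exm : exists m : nat, x <= m%:R ^+ k.
  exists (Num.bound x); apply: (@le_trans _ _ (Num.bound x)%:R).
    by rewrite ltW// archi_boundP// (le_trans ler01).
  rewrite -natrX ler_nat -[X in (X <= _)%N]expn1 leq_pexp2l//.
case: (ex_minnP exm) => m xm min_m.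
have m0 : (0 < m)%N.
  rewrite lt0n; apply: contraTneq xm => ->.
  by rewrite expr0n (gtn_eqF k0) -ltNge (lt_le_trans ltr01).
exists m => //; rewrite xm/=; case: m m0 xm min_m => // -[|m] _ xm min_m.
  rewrite expr1n -[X in X <= _]mulr1 ler_pM// exprn_ege1//.
  by rewrite (ler_nat _ 1 2).
have mx : m.+1%:R ^+ k <= x.
  by rewrite leNgt; apply/negP => /ltW/min_m; rewrite ltnn.
apply: (@le_trans _ _ (2 ^+ k * m.+1%:R ^+ k)); last by rewrite ler_wpM2l ?exprn_ge0.
by rewrite -exprMn lerXn2r ?nnegrE ?mulr_ge0// -natrM ler_nat; lia.
Qed.

(** * Union bound, independence and measurability *)

Section Probability.
Context {d : measure_display} {T : measurableType d} {R : realType}.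
Variable (P : probability T R).

Lemma probability_bigU_le (I : finType) (A : I -> set T) (e : R) :
  (forall i, measurable (A i)) -> (forall i, (P (A i) <= e%:E)%E) ->
  (P (\big[setU/set0]_i A i) <= (#|I|%:R * e)%:E)%E.
Proof.
move=> mA PA; apply: (@le_trans _ _ (\sum_(i : I) P (A i))%E); last first.
  rewrite mulr_natl -sumr_const -sumEFin; apply: lee_sum => i _; exact: PA.
suff [] : measurable (\big[setU/set0]_i A i) /\
    (P (\big[setU/set0]_i A i) <= \sum_(i : I) P (A i))%E by [].
elim/big_rec2: _ => [|i y B _ [mB PB]]; first by rewrite measure0.
split; first exact: measurableU.
by apply: le_trans (measureU2 _ _ _) _ => //; rewrite leeD2l.
Qed.

(** Each factor satisfies [1 - delta <= expR (- delta)]. *)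
Lemma independent_bigcap_le (I : finType) (D : I -> set T) (p : I -> R) (delta : R)
    (J : {set I}) :
  mutually_independent P D -> (forall i, P (D i) = (p i)%:E) ->
  (forall i, p i <= 1 - delta) ->
  (P (\bigcap_(i in [set` J]) D i) <= (expR (- (delta * #|J|%:R)))%:E)%E.
Proof.
move=> indep PD le_p; rewrite indep.
under eq_bigr do rewrite PD.
rewrite prodEFin lee_fin.
have -> : expR (- (delta * #|J|%:R)) = \prod_(i in J) expR (- delta) :> R.
  by rewrite prodr_const -expRM_natr mulNr.
apply: ler_prod => i _; apply/andP; split.
  by rewrite -lee_fin -PD measure_ge0.
by apply: le_trans (le_p i) _; exact: expR_ge1Dx.
Qed.

(** As the values lie in a countable set, the event is a countable union of finite intersections of
    point preimages, however complicated [Q] is. *)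
Lemma measurable_discrete_preimage (I : finType) (X : I -> T -> R) (c : nat -> R)
    (Q : {ffun I -> R} -> Prop) :
  (forall i, measurable_fun setT (X i)) ->
  (forall i w, exists m, X i w = c m) -> measurable [set w | Q [ffun i => X i w]].
Proof.
move=> mX XE.
rewrite (_ : mkset _ = \bigcup_(f in [set f : {ffun I -> nat} | Q [ffun i => c (f i)]])
    \bigcap_(i in [set: I]) (X i @^-1` [set c (f i)])).
  rewrite bigcup_mkcond; apply: countable_bigcupT_measurable => // f.
  case: ifP => // _; apply: fin_bigcap_measurable => // i _.
  by rewrite -[X in measurable X]setTI; exact: mX.
have XfE w (f : I -> nat) : (forall i, X i w = c (f i)) ->
    [ffun i => X i w] = [ffun i => c ([ffun j => f j] i)].
  by move=> fE; apply/ffunP => i; rewrite !ffunE.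
apply/seteqP; split=> w /=.
  move=> Qw; have [f fE] := choice (fun i => XE i w).
  exists [ffun i => f i]; first by rewrite /= -(XfE w).
  by move=> i _ /=; rewrite fE ffunE.
move=> [f /= Qf Xf]; suff -> : [ffun i => X i w] = [ffun i => c (f i)] by [].
by apply/ffunP => i; rewrite !ffunE; exact: Xf.
Qed.

End Probability.

(** * Logarithms, the strategy grid and strict dominance of [k] *)

(** From [ln 2 >= 1/2] the truncated logarithm is at most [2k + 2 ln n]; the remaining constants are
    absorbed by [ln n >= 1]. *)
Lemma trunc_log_le_ln (R : realType) (k n : nat) : (0 < k)%N ->
  1 <= ln n%:R :> R ->
  (trunc_log 2 (k * n)).+1%:R <= (2 * k + 3)%:R * ln n%:R :> R.
Proof.
move=> k0 ln1n; set t := trunc_log 2 (k * n).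
have n0 : (0 < n)%N.
  by rewrite lt0n; apply: contraTneq ln1n => ->; rewrite ln0// -ltNge.
have half_le_ln2 : 1 / 2 <= ln 2 :> R.
  have := @le_ln1Dx R (- (1 / 2)).
  have -> : 1 + - (1 / 2) = 2^-1 :> R by field.
  by rewrite lnV ?posrE//; lra.
have t_le : ln 2 * t%:R <= ln k%:R + ln n%:R :> R.
  rewrite -lnM ?posrE ?ltr0n// -natrM mulr_natr -lnXn// -natrX.
  rewrite ler_ln ?posrE ?ltr0n ?expn_gt0 ?muln_gt0 ?k0// ler_nat.
  by apply: trunc_logP; rewrite ?muln_gt0 ?k0.
have lnk : ln k%:R <= k%:R :> R by rewrite ltW// ln_sublinear// ltr0n.
have t0 : 0 <= t%:R :> R by [].
have kR0 : 0 <= k%:R :> R by [].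
rewrite -natr1 natrD natrM.
nra.
Qed.

(** Both [s] and [k = (k g) / g] are integer multiples of [1/g]. *)
Lemma strategy_gap (R : realType) (g k : nat) (s : R) : (0 < g)%N ->
  strategies g s -> s != k%:R ->
  0 <= s /\ (k%:R + g%:R^-1 <= s \/ s <= k%:R - g%:R^-1).
Proof.
move=> g0 [m ->] mk; have gR0 : 0 < g%:R :> R by rewrite ltr0n.
split; first by rewrite divr_ge0.
have kE : k%:R = (k * g)%:R / g%:R :> R by rewrite natrM mulfK ?gt_eqF.
move: mk; rewrite kE => mk.
have [lt|gt|eq] := ltngtP m (k * g)%N; last by rewrite eq eqxx in mk.
  right; rewrite -[X in _ - X]mul1r -mulrBl ler_pM2r ?invr_gt0//.
  by rewrite lerBrDr natr1 ler_nat.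
left; rewrite -[X in _ + X]mul1r -mulrDl ler_pM2r ?invr_gt0//.
by rewrite natr1 ler_nat.
Qed.

Lemma alpha_min_le (R : realType) (k n : nat) (alpha : node k n -> R) u :
  (forall v, 0 < alpha v) -> alpha_min alpha <= alpha u.
Proof.
move=> alpha0; apply: ge_inf; last by exists u.
by exists 0 => _ [v _ <-]; rewrite ltW.
Qed.

Section Dominance.
Context {R : realType} {k n g : nat}.
Variables (alpha : node k n -> R) (A eps G : R).
Hypotheses (k1 : (1 < k)%N) (n1 : (1 < n)%N) (g0 : (0 < g)%N).
Hypotheses (alpha_bounds : forall u, 0 < alpha u <= A) (eps0 : 0 < eps).
Hypothesis eps_small : 4 * eps < Num.min 1 (alpha_min alpha) * g%:R^-1.
Hypothesis constants_le : 2 * (k%:R ^+ k * (2 * k)%:R ^+ k) <= G.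
Hypothesis normalizer_le : forall u : node k n, normalizer u k%:R <= G.
Hypotheses (G1 : 1 <= G) (G_small : G `^ (4 * A + 6) <= n%:R `^ eps).

Lemma payoff_navigable_max (q : profile R k n) u v s :
  (forall w, strategies g (q w)) -> v != u -> q v = k%:R ->
  (torus_dist u v)%:R ^+ k <= G * n%:R `^ eps ->
  strategies g s -> s != k%:R ->
  payoff alpha u s q < payoff alpha u k%:R q.
Proof.
move=> qS vu qv dv ss sk.
have g_gt0 : 0 < g%:R^-1 :> R by rewrite invr_gt0 ltr0n.
have g_le1 : g%:R^-1 <= 1 :> R by rewrite invf_le1 ?ltr0n// ler1n.
have alpha0 w : 0 < alpha w by case/andP: (alpha_bounds w).
have nR1 : 1 < n%:R :> R by rewrite ltr1n.
have q0 w : 0 <= q w by have [m ->] := qS w; rewrite divr_ge0.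
have lt_gamma : 4 * eps < g%:R^-1.
  by apply: lt_le_trans eps_small _; rewrite ler_piMl ?(ltW g_gt0)// ge_min lexx.
have lt_alpha : 4 * eps < alpha u * g%:R^-1.
  apply: lt_le_trans eps_small _; rewrite ler_wpM2r ?(ltW g_gt0)//.
  by rewrite ge_min alpha_min_le ?orbT.
apply: lt_le_trans (payoff_navigable_ge k1 n1 alpha0 constants_le normalizer_le vu qv dv).
have [s0 [le_s|le_s]] := strategy_gap g0 ss sk.
  apply: le_lt_trans (payoff_above_le k1 n1 alpha0 g_gt0 g_le1 constants_le
    normalizer_le _ _ le_s) _.
  exact: navigable_beats_above lt_alpha G_small.
apply: le_lt_trans (payoff_below_le k1 n1 alpha0 g_gt0 constants_le
  normalizer_le _ _ q0) _.
  by rewrite s0 le_s.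
exact: navigable_beats_below lt_gamma G_small.
Qed.

End Dominance.

(** * Choice of the constants and the probabilistic conclusion *)

(* "Constant" exponents: bounded by some A that does not depend on n.
   D u is the event that u perturbs, and r' u the resulting strategy of u; the
   new strategies are arbitrary and may be correlated with one another and
   with the events D u. *)
Theorem theorem3p6 (R : realType) (k g : nat) (A eps : R) :
  (1 < k)%N -> (2 <= g)%N -> 0 < eps ->
  exists n0 : nat, forall n : nat, (n0 <= n)%N -> (2 <= n)%N ->
  forall alpha : node k n -> R,
  (forall u, 0 < alpha u <= A) ->
  eps < Num.min 1 (alpha_min alpha) * g%:R^-1 / 4 ->
  forall (d : measure_display) (T : measurableType d) (P : probability T R)
    (p : node k n -> R) (D : node k n -> set T)
    (r' : node k n -> {RV P >-> R}),
  (forall u, measurable (D u)) ->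
  mutually_independent P D ->
  (forall u, P (D u) = (p u)%:E) ->
  (forall u, p u <= 1 - n%:R `^ (- eps)) ->
  (forall u w, strategies g (r' u w)) ->
  (forall u w, ~ D u w -> r' u w = k%:R) ->
  let returned := [set w | moves_back g alpha [ffun u => r' u w]
                             (constant_profile k n k%:R)] in
  measurable returned /\ ((1 - n%:R^-1)%:E <= P returned)%E.
Proof.
move=> k1 g2 eps0; have k0 : (0 < k)%N := ltnW k1.
(* [c1 ln n] bounds the normalizer, [c2] is the constant of the payoff bounds, and [c3 ln n * n^eps]
   bounds [(k rho)^k] for the ball radius [k rho] chosen below. *)
pose c1 : R := 4 ^+ k * (2 * k + 3)%:R.
pose c2 : R := 2 * (k%:R ^+ k * (2 * k)%:R ^+ k).
pose c3 : R := (2 * k)%:R ^+ k * k.+1%:R.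
have [c1_ge0 c2_ge0] : 0 <= c1 /\ 0 <= c2 by split; rewrite !mulr_ge0 ?exprn_ge0.
have c3_ge1 : 1 <= c3.
  by rewrite /c3 -natrX -natrM ler1n muln_gt0 expn_gt0 muln_gt0 k0.
pose Z := c1 + c2 + c3; have Z0 : 0 < Z by rewrite /Z; lra.
(* The threshold is fixed before any [alpha] shows [A] to be positive; the absolute value keeps the
   exponent positive. *)
have [|n0 large] := @powR_ln_le_powR R Z (4 * `|A| + 6) eps Z0 _ eps0.
  by rewrite ltr_wpDl// mulr_ge0.
exists n0 => n /large[ln1n G_small] n1 alpha alpha_bounds eps_small.
move=> d T P p D r' mD indep PD p_le r'S r'k returned.
pose G := Z * ln n%:R; rewrite -/G in G_small.
have nR1 : 1 < n%:R :> R by rewrite ltr1n.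
have nR0 : 0 < n%:R :> R by rewrite (lt_trans ltr01).
have c_leG c : 0 <= c -> c <= Z -> c * ln n%:R <= G /\ c <= G.
  move=> c_ge0 cZ; have cG : c * ln n%:R <= G by rewrite ler_wpM2r// (le_trans ler01).
  by split=> //; apply: le_trans cG; rewrite ler_peMr.
have [c1G _] : c1 * ln n%:R <= G /\ c1 <= G by apply: c_leG; rewrite /Z; lra.
have [_ c2G] : c2 * ln n%:R <= G /\ c2 <= G by apply: c_leG; rewrite /Z; lra.
have [c3G c3G'] : c3 * ln n%:R <= G /\ c3 <= G by apply: c_leG; rewrite /Z; lra.
have G1 : 1 <= G := le_trans c3_ge1 c3G'.
have normalizer_le (u : node k n) : normalizer u k%:R <= G.
  apply: le_trans (normalizer_le_log k0 n1 u) _; apply: le_trans c1G.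
  by rewrite -mulrA ler_wpM2l ?exprn_ge0// trunc_log_le_ln.
have eps_small4 : 4 * eps < Num.min 1 (alpha_min alpha) * g%:R^-1 by lra.
have mreturned : measurable returned.
  apply: (measurable_discrete_preimage (X := fun u => r' u)
    (c := fun m => m%:R * g%:R^-1)
    (fun q => moves_back g alpha q (constant_profile k n k%:R))).
    by move=> u; exact: measurable_funP.
  by move=> u w; exact: r'S.
split => //.
have ne1 : 1 <= n%:R `^ eps :> R 
  by have := ler_powR (ltW nR1) (ltW eps0); rewrite powRr0.
(* With at least [x] nodes in the ball, the probability that all are perturbed is at most
   [expR (- (n^-eps * x)) = n^-(k+1)]. *)
pose x : R := n%:R `^ eps * (k.+1%:R * ln n%:R).
have x1 : 1 <= x.
  apply: le_trans ne1 _; rewrite ler_peMr ?powR_ge0//.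
  apply: (le_trans ln1n); rewrite ler_peMl ?ler1n//.
  exact: le_trans ler01 ln1n.
have [rho rho0 /andP[x_le rho_le]] := exists_expn_approx k0 x1.
have k_rho_le : (k * rho)%:R ^+ k <= G * n%:R `^ eps :> R.
  apply: (@le_trans _ _ (c3 * ln n%:R * n%:R `^ eps)); last first.
    by rewrite ler_wpM2r// powR_ge0.
  rewrite natrM exprMn; apply: le_trans (ler_wpM2l _ rho_le) _.
    by rewrite exprn_ge0.
  by rewrite /c3 /x natrM exprMn le_eqVlt; apply/orP; left; apply/eqP; ring.
(* Needed for the lower bound on the ball size: [rho <= (k rho)^k <= G n^eps <= n^(2 eps) < n], as
   [4 eps < 1]. *)
have rho_lt : (rho < n)%N.
  have G_le : G <= n%:R `^ eps.
    by apply: le_trans (le1r_powR G1 _) G_small; have := normr_ge0 A; lra.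
  have rho_le_sqr : rho%:R <= n%:R `^ eps * n%:R `^ eps :> R.
    apply: (@le_trans _ _ (rho%:R ^+ k)).
      by rewrite -natrX ler_nat -[X in (X <= _)%N]expn1 leq_pexp2l.
    apply: (@le_trans _ _ ((k * rho)%:R ^+ k)).
      by rewrite lerXn2r ?nnegrE// ler_nat leq_pmull.
    by apply: le_trans k_rho_le _; rewrite ler_wpM2r ?powR_ge0.
  rewrite ltnNge; apply/negP => n_le.
  have n_le_sqr : n%:R <= n%:R `^ eps * n%:R `^ eps :> R.
    by apply: le_trans rho_le_sqr; rewrite ler_nat.
  move: n_le_sqr; rewrite -powRD ?(gt_eqF nR0) ?implybT//.
  rewrite -{1}(powRr1 (ltW nR0)) leNgt => /negP; apply.
  rewrite /powR gt_eqF// ltr_expR ltr_pM2r ?ln_gt0//.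
  have : Num.min 1 (alpha_min alpha) * g%:R^-1 <= 1.
    apply: (@le_trans _ _ g%:R^-1); last by rewrite invf_le1 ?ltr0n ?ler1n// ltnW.
    by rewrite ler_piMl ?invr_ge0// ge_min lexx.
  lra.
pose J (u : node k n) := [set v : node k n | (v != u) && (torus_dist u v <= k * rho)%N]%SET.
pose bad (u : node k n) := \bigcap_(v in [set` J u]) D v.
have bad_le u : (P (bad u) <= (n%:R ^- k.+1)%:E)%E.
  apply: le_trans (independent_bigcap_le (J u) indep PD p_le) _.
  rewrite lee_fin.
  have -> : n%:R ^- k.+1 = expR (- (k.+1%:R * ln n%:R)) :> R.
    by rewrite expRN mulrC expRM_natr lnK.
  rewrite ler_expR lerN2.
  have -> : k.+1%:R * ln n%:R = n%:R `^ (- eps) * x.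
    by rewrite powRN /x mulKf// gt_eqF// powR_gt0.
  rewrite ler_wpM2l ?powR_ge0//; apply: le_trans x_le _.
  rewrite -natrX ler_nat; apply: leq_trans (card_punctured_ball_ge u k0 rho_lt) _.
  by apply/subset_leq_card/fintype.subsetP => v; rewrite !inE.
have mbad u : measurable (bad u) by exact: fin_bigcap_measurable.
have union_le : (P (\big[setU/set0]_u bad u) <= (n%:R^-1)%:E)%E.
  apply: le_trans (probability_bigU_le mbad bad_le) _.
  rewrite lee_fin card_ffun !card_ord natrX exprS invfM.
  by rewrite mulrCA mulfV ?mulr1// expf_neq0 ?gt_eqF.
have mU : measurable (\big[setU/set0]_u bad u).
  exact: bigsetU_measurable.
have sub : ~` (\big[setU/set0]_u bad u) `<=` returned.
  move=> w nbad; rewrite /returned /=.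
  (* The unperturbed nodes are the fixed ones; off the bad events every [u] has one of them in
     [J u]. *)
  apply: (@moves_back_dominant _ _ _ _ _ _ (fun v => ~ D v w)).
  - by exists (k * g)%N; rewrite natrM mulfK// pnatr_eq0 -lt0n (leq_trans _ g2).
  - move=> q u s [qS qk] ss sk.
    have [v] : exists v, v \in J u /\ ~ D v w.
      apply: contrapT => noJ; apply: nbad.
      rewrite -bigcup_seq; exists u; first by rewrite /= mem_index_enum.
      move=> v /= vJ; apply: contrapT => nD; apply: noJ; by exists v.
    rewrite inE => -[/andP[vu dv] nDv].
    apply: (payoff_navigable_max (A := `|A|) (eps := eps) (G := G) k1 n1 _ _ _ _ _
      normalizer_le _ _ qS vu (qk v nDv) _ ss sk) => //.
    + exact: ltnW.
    + move=> y; have /andP[-> /le_trans] := alpha_bounds y; apply; exact: ler_norm.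
    + by apply: le_trans k_rho_le; rewrite lerXn2r ?nnegrE// ler_nat.
  - by split=> v; rewrite ffunE; [exact: r'S|exact: r'k].
apply: (@le_trans _ _ (P (~` (\big[setU/set0]_u bad u)))); last first.
  by apply: le_measure; rewrite ?inE//; exact: measurableC.
by rewrite probability_setC// EFinB leeD2l// leeN2.
Qed.
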